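(* Let $(V,\mu)$ and $(E,\tau)$ be positive measure spaces with $0<\mu(V)<\infty$, and let $K:V\times E\to[0,\infty)$ be measurable with $\int_V K(v,e)\,d\mu(v)=1$ for $\tau$-a.e. $e\in E$. Let $g:E\to[0,\infty)$ be integrable, let $\Lambda\subseteq E$ be measurable, and set \[ E_\Lambda=E\setminus\Lambda,\qquad s_\Lambda=\int_{E_\Lambda}g\,d\tau,\qquad T_\Lambda g(v)=\int_{E_\Lambda}K(v,e)g(e)\,d\tau(e). \] If $s_\Lambda>0$, then for every $p\ge1$ (with $p<\infty$), \[ \|T_\Lambda g\|_{L^p(V,\mu)}\ge\mu(V)^{\frac1p-1}s_\Lambda . \] For $p>1$, equality holds if and only if $T_\Lambda g=s_\Lambda/\mu(V)$ $\mu$-a.e.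
   Context: A positive measure space is a measure space equipped with a positive measure. All functions and kernels are assumed measurable whenever required (kernels with respect to the product), and all stated integrals are assumed to be well defined. *)

(* Defs.v *)
From HB Require Import structures.
From mathcomp Require Import all_boot all_order all_algebra.
From mathcomp Require Import all_classical all_reals all_analysis.

Set Implicit Arguments.
Unset Strict Implicit.
Unset Printing Implicit Defensive.

Local Open Scope classical_set_scope.
Local Open Scope ring_scope.
Local Open Scope ereal_scope.

Definition mass_off (d : measure_display) (E : measurableType d) (R : realType)
    (tau : {measure set E -> \bar R}) (g : E -> R) (L : set E) : \bar R :=
  \int[tau]_(e in ~` L) (g e)%:E.

(* Extended-real valued: the integral of the nonnegative integrand may be
   +oo at some points v. *)
Definition kernel_off (d1 d2 : measure_display) (V : measurableType d1)
    (E : measurableType d2) (R : realType) (tau : {measure set E -> \bar R})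
    (K : V * E -> R) (g : E -> R) (L : set E) (v : V) : \bar R :=
  \int[tau]_(e in ~` L) (K (v, e) * g e)%:E.

(* Main.v *)
Require Import Defs.
From HB Require Import structures.
From mathcomp Require Import all_boot all_order all_algebra.
From mathcomp Require Import all_classical all_reals all_analysis.
From mathcomp Require Import measurable_realfun ring lra.

Import Order.TTheory GRing.Theory Num.Theory.

Local Open Scope classical_set_scope.
Local Open Scope ring_scope.
Local Open Scope ereal_scope.

(* Tonelli's theorem and the normalisation of K give that the integral of
   f := T_Lambda g over V is s_Lambda, so f has mean a := s_Lambda / mu(V).
   For p > 1 the convex function t |-> t ^ p lies above its tangent line at a
   and touches it only there; integrating the nonnegative gap shows that
   the integral of f ^ p is a ^ p * mu(V) plus the integral of the gap, which
   vanishes exactly when f = a almost everywhere. *)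

(** * Tangent line of a real power and Jensen's inequality *)

Lemma powR_pred (R : realType) (a p : R) :
  (0 < a)%R -> (a `^ p = a `^ (p - 1) * a)%R.
Proof.
move=> a0; rewrite -[X in (_ * X)%R](powRr1 (ltW a0)) -powRD ?subrK//.
by rewrite (gt_eqF a0) implybT.
Qed.

(* With t = a * expR x, add the inequalities 1 + y <= expR y at
   y = (p - 1) * x and, multiplied by p - 1, at y = - x. *)
Lemma powR_tangent (R : realType) (p a t : R) :
  (1 < p)%R -> (0 < a)%R -> (0 <= t)%R ->
  (p * a `^ (p - 1) * t <= t `^ p + (p - 1) * a `^ p ?= iff (t == a))%R.
Proof.
move=> p1 a0 t0.
have ap := powR_pred R a p a0.
have [->|ta] := eqVneq t a.
  rewrite (_ : (a `^ p + _ = p * a `^ (p - 1) * a)%R); last by rewrite ap; ring.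
  exact/leif_refl.
suff lt_tan : (p * a `^ (p - 1) * t < t `^ p + (p - 1) * a `^ p)%R.
  by split; rewrite (ltW, lt_eqF).
(* The logarithm below needs [t > 0]; at 0 the tangent is already negative, since [p > 1]. *)
have [->|tn0] := eqVneq t 0%R.
  rewrite mulr0 powR0 ?(gt_eqF (lt_trans ltr01 p1))// add0r.
  by rewrite mulr_gt0 ?powR_gt0// subr_gt0.
have {tn0}t0 : (0 < t)%R by rewrite lt_def tn0.
pose x := (ln t - ln a)%R.
have x0 : x != 0%R.
  by apply: contra ta => /eqP/subr0_eq/ln_inj ->//; rewrite posrE.
have tx : (t = a * expR x)%R.
  by rewrite -{1}(lnK t0) -{1}(lnK a0) -expRD /x; congr expR; ring.
have tp : (t `^ p = a `^ p * (expR x * expR ((p - 1) * x)))%R.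
  rewrite tx powRM ?expR_ge0 ?(ltW a0)// -expRM -expRD; congr (_ * expR _)%R.
  ring.
have e1 : (1 - x <= expR (- x))%R by rewrite expR_ge1Dx.
have e2 : (1 + (p - 1) * x < expR ((p - 1) * x))%R.
  by rewrite expR_gt1Dx// mulf_neq0// subr_eq0 gt_eqF.
have ex : (expR x * expR (- x) = 1)%R by rewrite -expRD subrr expR0.
(* Inserting [expR x * expR (- x) = 1] lets both sides share the factor [a ^ p * expR x]. What
   remains is [p < expR ((p - 1) * x) + (p - 1) * expR (- x)], the sum of [e2] and [p - 1] times
   [e1]. *)
have -> : (t `^ p + (p - 1) * a `^ p =
    a `^ p * (expR x * (expR ((p - 1) * x) + (p - 1) * expR (- x))))%R.
  by rewrite tp -[X in (_ + X = _)%R]mulr1 -ex; ring.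
rewrite {1}tx (_ : (_ * _ * _ = a `^ p * (expR x * p))%R); last first.
  by rewrite ap; ring.
rewrite ltr_pM2l ?powR_gt0// ltr_pM2l ?expR_gt0//.
have : ((p - 1) * (1 - x) <= (p - 1) * expR (- x))%R.
  by rewrite ler_pM2l// subr_gt0.
lra.
Qed.

(** Values of [f] and the integral of its power may be infinite, so only finite terms are ever
    subtracted. *)
Lemma Jensen_poweR (R : realType) (d : measure_display)
    (T : measurableType d) (mu : {measure set T -> \bar R}) (m a p : R)
    (f : T -> \bar R) :
  mu setT = m%:E -> (1 < p)%R -> (0 < a)%R ->
  measurable_fun setT f -> (forall x, 0 <= f x) ->
  \int[mu]_x f x = (a * m)%:E ->
  (a `^ p * m)%:E <= \int[mu]_x (f x `^ p) /\
  (\int[mu]_x (f x `^ p) = (a `^ p * m)%:E <->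
   {ae mu, forall x, f x = a%:E}).
Proof.
move=> muT p1 a0 mf f0 intf.
have p0 : (0 < p)%R by exact: lt_trans p1.
set k := (p * a `^ (p - 1))%R; set c := ((p - 1) * a `^ p)%R.
have k0 : (0 < k)%R by rewrite mulr_gt0// powR_gt0.
have c0 : (0 <= c)%R by rewrite mulr_ge0 ?powR_ge0// subr_ge0 ltW.
(* The tangent line at [a] is [k * t - c]; since [f] has mean [a], it integrates to [a ^ p * m]. *)
have kam : (k * (a * m) = c * m + a `^ p * m)%R.
  by rewrite /c /k (powR_pred R a p a0); ring.
have tan x := powR_tangent _ _ _ _ p1 a0 (fine_ge0 (f0 x)).
pose q x := (fine (f x) `^ p + c - k * fine (f x))%:E.
have q0 x : 0 <= q x by rewrite lee_fin subr_ge0 tan.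
have mff : measurable_fun setT (fine \o f) by exact: measurableT_comp.
have mq : measurable_fun setT q.
  apply/measurable_EFinP/measurable_funB.
    apply: measurable_funD => //.
    exact: (measurableT_comp (measurable_powR p) mff).
  exact: measurable_funM.
have mfp : measurable_fun setT (fun x => f x `^ p).
  exact: (measurableT_comp (measurable_poweR p) mf).
(* at f x = +oo both sides are +oo, as q x is always finite *)
have split_fp x : f x `^ p + c%:E = q x + k%:E * f x.
  rewrite /q; case: (f x) (f0 x) => [t| |]// t0.
    by rewrite poweR_EFin -!EFinD /=; congr EFin; ring.
  by rewrite poweRyr ?gt_eqF// gt0_muley ?lte_fin.
have intfp : \int[mu]_x (f x `^ p) = \int[mu]_x q x + (a `^ p * m)%:E.
  have : \int[mu]_x (f x `^ p + c%:E) = \int[mu]_x (q x + k%:E * f x).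
    by apply: eq_integral => x _; exact: split_fp.
  rewrite ge0_integralD//; last by move=> x _; exact: poweR_ge0.
  rewrite ge0_integralD//; last 2 first.
  - by move=> x _; rewrite mule_ge0// lee_fin ltW.
  - exact: measurable_funeM.
  rewrite integral_cst// muT ge0_integralZl_EFin// ?(ltW k0)// intf.
  rewrite -!EFinM kam EFinD addeA addeAC => /(congr1 (fun z => z - (c * m)%:E)).
  by rewrite !addeK.
have qf x : q x = 0 <-> f x = a%:E.
  have qa : q x = 0 <-> fine (f x) = a.
    rewrite /q; split=> [[/eqP]|/eqP].
      by rewrite subr_eq0 eq_sym (tan x) => /eqP.
    by rewrite -(tan x) eq_sym -subr_eq0 => /eqP ->.
  rewrite qa; split => [|->//].
  (* the junk value fine +oo = 0 differs from a *)
  by case: (f x) => [t /= ->//|/= a_eq0|/= a_eq0]; rewrite -a_eq0 ltxx in a0.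
rewrite intfp; split; first by apply: leeDr; exact: integral_ge0.
(* Equality in Jensen means that the nonnegative gap [q] has integral zero, hence vanishes almost
   everywhere. *)
have -> : (\int[mu]_x q x + (a `^ p * m)%:E = (a `^ p * m)%:E) <->
    \int[mu]_x `|q x| = 0.
  under [X in _ <-> X = _]eq_integral do rewrite gee0_abs//.
  split => [/(congr1 (fun z => z - (a `^ p * m)%:E))|->]; last by rewrite add0e.
  by rewrite addeK// subee.
rewrite (ae_eq_integral_abs mu measurableT mq).
split; apply: filterS => x; first by move=> /(_ I)/qf.
by move=> fxa _; apply/qf.
Qed.

(** * Restriction to the positivity set of an integrable function *)

Lemma ge0_integral_mrestr (d : measure_display) (T : measurableType d)
    (R : realType) (tau : {measure set T -> \bar R}) (D : set T)
    (mD : measurable D) (f : T -> \bar R) :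
  measurable_fun setT f -> (forall x, 0 <= f x) ->
  \int[mrestr tau mD]_x f x = \int[tau]_(x in D) f x.
Proof.
move=> mf f0; have mDc := measurableC mD.
have mfD : measurable_fun setT (f \_ D).
  by apply/measurable_restrict => //; rewrite setTI; apply: measurable_funTS.
have fD0 x : setT x -> 0 <= (f \_ D) x by move=> _; rewrite patchE; case: ifP.
rewrite [RHS]integral_mkcond.
(* tau is the sum of its restrictions to D and to ~` D *)
rewrite [RHS](eq_measure_integral
  (measure_add (mrestr tau mD) (mrestr tau mDc))); last first.
  move=> A mA _; apply: etrans (esym (measure_addE _ _ _)).
  rewrite /= /mrestr -measureU//.
  - by rewrite -setIUr setUv setIT.
  - exact: measurableI.
  - exact: measurableI.
  - by rewrite setIACA setICr setI0.
rewrite ge0_integral_measure_add//.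
(* The part of [tau] on the complement of [D] contributes nothing, because [f \_ D] vanishes
   there. *)
rewrite [X in _ = _ + X](_ : _ = 0) ?adde0; last first.
  under eq_integral do rewrite -(gee0_abs (fD0 _ I)).
  apply/(ae_eq_integral_abs _ measurableT mfD).
  exists D; split => //; first by rewrite /= /mrestr setICr measure0.
  move=> x /= +; rewrite patchE; apply: contra_notP => xD _.
  by rewrite memNset.
apply: ge0_ae_eq_integral => //.
exists (~` D); split => //; first by rewrite /= /mrestr setICl measure0.
by move=> x /=; apply: contra_not => xD _; rewrite patchE mem_set.
Qed.

(** By Markov's inequality each set where [g] is at least [1 / (n + 1)] in absolute value has finite
    measure, and these sets cover [D]. The complement of [D], null for the restriction, is added to
    cover the whole space. *)
Lemma sigma_finite_mrestr_integrable (d : measure_display)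
    (T : measurableType d) (R : realType) (tau : {measure set T -> \bar R})
    (g : T -> R) (D : set T) (mD : measurable D) :
  tau.-integrable setT (EFin \o g) -> (forall x, D x -> (0 < g x)%R) ->
  sigma_finite setT (mrestr tau mD).
Proof.
move=> gi gD; have [mg goo] := integrableP _ _ _ gi.
pose F n := [set x | (n.+1%:R^-1)%:E <= `|(g x)%:E| ].
have mF n : measurable (F n).
  rewrite -[F n]setTI; apply: emeasurable_fun_c_infty => //.
  exact: measurableT_comp.
have Foo n : tau (F n) < +oo.
  have : (n.+1%:R^-1)%:E * tau (F n) <= \int[tau]_x `|(EFin \o g) x|.
    by rewrite -[F n]setTI;
      apply: (@le_integral_comp_abse _ _ _ tau _ measurableT _ _ id).
  move=> /le_lt_trans/(_ goo).
  rewrite muleC -lte_pdivlMr ?invr_gt0// => /lt_le_trans -> //.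
  by rewrite leey.
exists (fun n => F n `|` ~` D).
  apply/seteqP; split => // x _.
  have [xD|xD] := pselect (D x); last by exists 0%N => //; right.
  have gx := gD _ xD.
  (* With [n] the integer part of [1 / g x], one has [1 / g x < n + 1]. *)
  exists (Num.truncn (g x)^-1) => //; left; rewrite /F /= lee_fin gtr0_norm//.
  by rewrite -[leRHS]invrK lef_pV2 ?posrE ?invr_gt0// ltW// truncnS_gt.
move=> n; split; first by apply: measurableU => //; exact: measurableC.
rewrite /mrestr setIUl setICl setU0; apply: le_lt_trans (Foo n).
by apply: le_measure; rewrite ?inE//; exact: measurableI.
Qed.

(** * Tonelli's theorem for the kernel *)

Lemma tonelli_kernel (R : realType) (d1 d2 : measure_display)
    (V : measurableType d1) (E : measurableType d2)
    (mu : {sigma_finite_measure set V -> \bar R})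
    (nu : {sigma_finite_measure set E -> \bar R})
    (K : V * E -> R) (g : E -> R) :
  measurable_fun setT K -> (forall x, (0 <= K x)%R) ->
  measurable_fun setT g -> (forall e, (0 <= g e)%R) ->
  {ae nu, forall e, \int[mu]_v (K (v, e))%:E = 1} ->
  measurable_fun setT (fun v => \int[nu]_e (K (v, e) * g e)%:E) /\
  \int[mu]_v \int[nu]_e (K (v, e) * g e)%:E = \int[nu]_e (g e)%:E.
Proof.
move=> mK K0 mg g0 K1.
pose f (x : V * E) := (K x * g x.2)%:E.
have mf : measurable_fun setT f.
  apply/measurable_EFinP/measurable_funM => //.
  exact: (measurableT_comp mg measurable_snd).
have f0 x : 0 <= f x by rewrite lee_fin mulr_ge0.
split; first exact: (measurable_fun_fubini_tonelli_F f).
rewrite (fubini_tonelli f)//.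
apply: ge0_ae_eq_integral => //.
- exact: (measurable_fun_fubini_tonelli_G f).
- exact/measurable_EFinP.
- by move=> e _; apply: integral_ge0.
- by move=> e _; rewrite lee_fin.
apply: filterS K1 => e Ke _.
rewrite /f /=; under eq_integral do rewrite EFinM muleC.
rewrite ge0_integralZl// ?Ke ?mule1//.
- by apply/measurable_EFinP; exact: measurableT_comp.
- by move=> v _; rewrite lee_fin.
- by rewrite lee_fin.
Qed.

(** Turns a proof of sigma-finiteness into the bundled structure that [tonelli_kernel] takes. *)
Lemma sigma_finite_measure_pack (R : realType) (d : measure_display)
    (T : measurableType d) (mu : {measure set T -> \bar R}) :
  sigma_finite setT mu ->
  exists nu : {sigma_finite_measure set T -> \bar R},
    mu = nu :> (set T -> \bar R).
Proof.
move=> sf.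
pose sfin :=
  isSFinite.Build _ _ _ _ (@sfinite_measure_sigma_finite _ _ _ mu sf).
pose sigmafin := isSigmaFinite.Build _ _ _ _ sf.
pose nu := HB.pack_for (SigmaFiniteMeasure.type T R) (Measure.sort mu)
  sfin sigmafin.
by exists nu.
Qed.

(* [tau] need not be sigma-finite, but only its restriction to the set where
   the integrable function [g] is positive matters. *)
Lemma integral_kernel_off (R : realType) (d1 d2 : measure_display)
    (V : measurableType d1) (E : measurableType d2)
    (mu : {measure set V -> \bar R}) (tau : {measure set E -> \bar R})
    (K : V * E -> R) (g : E -> R) (L : set E) :
  sigma_finite setT mu -> measurable_fun setT K -> (forall x, (0 <= K x)%R) ->
  {ae tau, forall e, \int[mu]_v (K (v, e))%:E = 1} ->
  (forall e, (0 <= g e)%R) -> tau.-integrable setT (EFin \o g) ->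
  measurable L ->
  measurable_fun setT (kernel_off tau K g L) /\
  \int[mu]_v kernel_off tau K g L v = mass_off tau g L.
Proof.
move=> sfmu mK K0 K1 g0 gi mL.
have mg : measurable_fun setT g.
  by apply/measurable_EFinP; exact: measurable_int gi.
pose D := ~` L `&` [set e | (0 < g e)%R].
have mD : measurable D.
  apply: measurableI; first exact: measurableC.
  have := emeasurable_fun_o_infty measurableT (measurable_int _ gi) 0.
  by rewrite setTI.
(* Used twice: with [h] equal to [g], and to [K (v, e) * g e] for fixed [v]. *)
have offE (h : E -> R) : measurable_fun setT h -> (forall e, (0 <= h e)%R) ->
    (forall e, g e = 0%R -> h e = 0%R) ->
    \int[tau]_(e in ~` L) (h e)%:E = \int[mrestr tau mD]_e (h e)%:E.
  move=> mh h0 hg; rewrite ge0_integral_mrestr//; last exact/measurable_EFinP.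
  rewrite integral_mkcondr; apply: eq_integral => e _.
  rewrite patchE; case: ifPn => // /negP; rewrite inE/= => /negP.
  rewrite -leNgt => ge.
  by rewrite hg//; apply/eqP; rewrite eq_le ge g0.
have [mu' muE] := sigma_finite_measure_pack _ _ _ _ sfmu.
have [nu nuE] := sigma_finite_measure_pack _ _ _ _
  (sigma_finite_mrestr_integrable _ _ _ _ _ _ mD gi (fun e De => De.2)).
(* A [tau]-null set stays null under restriction to [D]. *)
have K1nu : {ae nu, forall e, \int[mu']_v (K (v, e))%:E = 1}.
  rewrite -nuE -muE; case: K1 => N [mN N0 sub]; exists N; split => //.
  apply: (@subset_measure0 _ _ _ tau (N `&` D) N) => //.
  exact: measurableI.
have [] := tonelli_kernel _ _ _ _ _ mu' nu K g mK K0 mg g0 K1nu.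
have kE : kernel_off tau K g L = fun v => \int[nu]_e (K (v, e) * g e)%:E.
  apply/funext => v; rewrite /kernel_off -nuE; apply: offE.
  - apply: measurable_funM => //; exact: measurableT_comp.
  - by move=> e; rewrite mulr_ge0.
  - by move=> e ->; rewrite mulr0.
by rewrite -kE -muE -nuE /mass_off offE.
Qed.

Theorem proposition2p10 (R : realType) (d1 d2 : measure_display)
  (V : measurableType d1) (E : measurableType d2)
  (mu : {measure set V -> \bar R}) (tau : {measure set E -> \bar R})
  (muV_gt0 : 0 < mu [set: V]) (muV_fin : mu [set: V] < +oo)
  (K : V * E -> R) (K_meas : measurable_fun [set: V * E] K)
  (K_ge0 : forall x : V * E, (0 <= K x)%R)
  (K_int : {ae tau, forall e : E, \int[mu]_v (K (v, e))%:E = 1})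
  (g : E -> R) (g_ge0 : forall e : E, (0 <= g e)%R)
  (g_int : tau.-integrable [set: E] (fun e : E => (g e)%:E))
  (L : set E) (L_meas : measurable L)
  (s_gt0 : 0 < mass_off tau g L) :
  (forall p : R, (1 <= p)%R ->
     mu [set: V] `^ (p^-1 - 1)%R * mass_off tau g L
       <= 'N[mu]_(p%:E)[kernel_off tau K g L]) /\
  (forall p : R, (1 < p)%R ->
     ('N[mu]_(p%:E)[kernel_off tau K g L]
        = mu [set: V] `^ (p^-1 - 1)%R * mass_off tau g L
      <->
      {ae mu, forall v : V,
         kernel_off tau K g L v = mass_off tau g L / mu [set: V]})).
Proof.
have sfmu : sigma_finite setT mu.
  exists (fun=> setT) => [|n]; last by split.
  by rewrite bigcup_const//; exists 0%N.
have [mf intf] := integral_kernel_off _ _ _ _ _ _ _ _ _ _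
  sfmu K_meas K_ge0 K_int g_ge0 g_int L_meas.
set f := kernel_off tau K g L in mf intf *.
set s := mass_off tau g L in s_gt0 intf *.
have f0 v : 0 <= f v by apply: integral_ge0 => e _; rewrite lee_fin mulr_ge0.
have s_fin : s \is a fin_num.
  rewrite ge0_fin_numE ?ltW//; have [_] := integrableP _ _ _ g_int.
  apply: le_lt_trans; rewrite /s /mass_off.
  under [X in _ <= X]eq_integral do rewrite gee0_abs ?lee_fin//.
  apply: ge0_subset_integral => //; first exact: measurableC.
  - exact: measurable_int g_int.
  - by move=> e _; rewrite lee_fin.
have m_fin : mu setT \is a fin_num by rewrite ge0_fin_numE.
rewrite -(fineK s_fin) -(fineK m_fin) in s_gt0 muV_gt0 intf *.
have muE := esym (fineK m_fin).
set m := fine (mu setT) in muV_gt0 muE *; set t := fine s in s_gt0 intf *.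
rewrite lte_fin in s_gt0; rewrite lte_fin in muV_gt0.
have mn0 : m != 0%R by rewrite gt_eqF.
pose a := (t / m)%R.
have a0 : (0 < a)%R by rewrite divr_gt0.
have am : (a * m = t)%R by rewrite divfK.
have NE p : 'N[mu]_(p%:E)[f] = (\int[mu]_v (f v `^ p)) `^ p^-1.
  by rewrite unlock; under eq_integral do rewrite gee0_abs//.
(* As [t = a * m], the claimed bound is the [p]-th root of Jensen's lower bound. *)
have cE p : (1 < p)%R ->
    m%:E `^ (p^-1 - 1)%R * t%:E = (a `^ p * m)%:E `^ p^-1.
  move=> p1; rewrite !poweR_EFin -EFinM; congr EFin.
  rewrite powRM ?powR_ge0 ?(ltW muV_gt0)// -powRrM.
  rewrite divff ?gt_eqF ?(lt_trans ltr01)//.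
  rewrite (powRr1 (ltW a0)) powRB ?mn0 ?implybT// (powRr1 (ltW muV_gt0)).
  by rewrite /a; ring.
have J p p1 := Jensen_poweR _ _ _ mu m a p f muE p1 a0 mf f0
  (etrans intf (congr1 EFin (esym am))).
split=> p; last first.
  move=> p1; have p0 : (0 < p)%R by exact: lt_trans p1.
  have -> : t%:E / m%:E = a%:E by rewrite inver (negPf mn0).
  rewrite -(J p p1).2 NE cE//; split=> [|->//].
  (* Raising to the power [p] undoes the root on nonnegative extended reals. *)
  move=> /(congr1 (fun z => z `^ p)); rewrite -!poweRrM mulVf ?gt_eqF//.
  rewrite !poweRe1 ?lee_fin ?mulr_ge0 ?powR_ge0 ?(ltW muV_gt0)//.
  by apply: integral_ge0 => v _; exact: poweR_ge0.
(* For [p = 1] the norm is the integral of [f], so equality always holds. *)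
rewrite le_eqVlt => /predU1P[<-|p1].
  rewrite invr1 subrr poweRe0 mul1e Lnorm1.
  by under eq_integral do rewrite gee0_abs//; rewrite intf.
rewrite NE cE//; apply: gt0_ler_poweR.
- by rewrite invr_ge0 ltW// (lt_trans ltr01).
- by rewrite in_itv/= leey lee_fin mulr_ge0 ?powR_ge0// ltW.
- rewrite in_itv/= leey andbT.
  by apply: integral_ge0 => v _; exact: poweR_ge0.
- exact: (J p p1).1.
Qed.
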